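(* Let $T$ be a unimodular tournament on $n$ vertices, and let $S$ be its skew-adjacency matrix. Then all off-diagonal entries of $S^{-1}$ are odd integers. Moreover, the following assertions are equivalent: (i) $T$ is invertible. (ii) Every subtournament of $T$ on $n-2$ vertices is unimodular. (iii) The coefficient of $x^{2}$ in the characteristic polynomial of $S$ is $\binom{n}{2}$.
   Context: The skew-adjacency matrix of a tournament with vertex set $\{v_1,\ldots,v_n\}$ is the $n\times n$ zero-diagonal matrix $S=[s_{ij}]$ in which $s_{ij}=1$ and $s_{ji}=-1$ if $v_i$ dominates $v_j$. The determinant of a tournament is the determinant of its skew-adjacency matrix, and a tournament is unimodular if its determinant is $1$ (by convention the empty tournament has determinant $1$). A unimodular tournament $T$ with skew-adjacency matrix $S$ is invertible if $S^{-1}$ is the skew-adjacency matrix of a tournament. The characteristic polynomial of $S$ is the monic polynomial $\phi_S(x)=\det(xI_n-S)$. A subtournament is the tournament induced on a subset of the vertices. *)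

(* Defs.v *)
From mathcomp Require Import all_boot all_order all_algebra.

Set Implicit Arguments.
Unset Strict Implicit.
Unset Printing Implicit Defensive.

Import GRing.Theory.
Local Open Scope ring_scope.

Record tournament (n : nat) := Tournament {
  dominates : rel 'I_n;
  dominates_irr : irreflexive dominates;
  dominates_total : forall i j, i != j -> dominates i j (+) dominates j i
}.

(* Over rat rather than int, so that the integrality of the entries of the
   inverse matrix is not built into its type. *)
Definition skew_adjacency n (T : tournament n) : 'M[rat]_n :=
  \matrix_(i, j) (if dominates T i j then 1
                  else if dominates T j i then -1 else 0).

(* For n = 0 this holds, since the determinant of the empty matrix is 1. *)
Definition unimodular n (T : tournament n) : Prop :=
  \det (skew_adjacency T) = 1.

Definition invertible n (T : tournament n) : Prop :=
  unimodular T /\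
  exists T' : tournament n, invmx (skew_adjacency T) = skew_adjacency T'.

(* The vertices in A are relabelled by 'I_#|A| in increasing order. *)
Definition sub_dominates n (T : tournament n) (A : {set 'I_n}) : rel 'I_#|A| :=
  fun i j => dominates T (enum_val i) (enum_val j).

Lemma sub_dominates_irr n (T : tournament n) (A : {set 'I_n}) :
  irreflexive (sub_dominates T (A := A)).
Proof. by move=> i; apply: dominates_irr. Qed.

Lemma sub_dominates_total n (T : tournament n) (A : {set 'I_n}) (i j : 'I_#|A|) :
  i != j -> sub_dominates T i j (+) sub_dominates T j i.
Proof.
move=> neq_ij; apply: dominates_total.
by rewrite (inj_eq enum_val_inj).
Qed.

Definition subtournament n (T : tournament n) (A : {set 'I_n}) : tournament #|A| :=
  Tournament (@sub_dominates_irr n T A) (@sub_dominates_total n T A).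

(* Main.v *)
(* Let S be the skew-adjacency matrix and B its inverse; B is skew-symmetric and
   integral.  Modulo 2, S is J - I with n even, hence an involution, so B is J - I modulo 2.
   By Jacobi's identity the principal minor of S avoiding {i, j} is the
   principal minor of B on {i, j}, that is B_ij^2, and the coefficient of x^2 is the sum
   of all B_ij^2 over i < j.  As every B_ij is odd, each of (i), (ii), (iii)
   says that B_ij = 1 or -1 whenever i != j.  The coefficient is computed from
   phi_S(x)^2 = det(x I - S) det(x I + S) = phi_{S^2}(x^2), in which only
   coefficients expressible by traces of B and B^2 occur. *)
Require Import Defs.
From mathcomp Require Import all_boot all_order all_algebra.
From mathcomp Require Import perm ring.

Set Implicit Arguments.
Unset Strict Implicit.
Unset Printing Implicit Defensive.

Import Order.TTheory GRing.Theory Num.Theory.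
Local Open Scope ring_scope.

(** * Reindexed matrices and complementary minors *)

(** Rows and columns are permuted alike, so the two signs cancel. The sizes [m] and [n] are kept
    distinct because the block decomposition below is indexed by [#|A| + #|~: A|], equal but not
    convertible to [n]. *)
Lemma det_mxsub_bij (R : comPzRingType) m n (f : 'I_m -> 'I_n) (A : 'M[R]_n) :
  bijective f -> \det (mxsub f f A) = \det A.
Proof.
move=> bij_f; have eq_mn : m = n.
  by have := bij_eq_card bij_f; rewrite !card_ord.
case: _ / eq_mn => // in f A bij_f *.
pose s := perm (bij_inj bij_f).
have -> : mxsub f f A = row_perm s (col_perm s A).
  by apply/matrixP=> i j; rewrite !mxE !permE.
rewrite row_permE col_permE !det_mulmx !det_perm odd_permV mulrCA -signr_addb.
by rewrite addbb mulr1.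
Qed.

Lemma mulmx_mxsub_bij (R : pzSemiRingType) m n (f : 'I_m -> 'I_n)
    (A B : 'M[R]_n) :
  bijective f -> mxsub f f A *m mxsub f f B = mxsub f f (A *m B).
Proof.
move=> bij_f; apply/matrixP=> i j; rewrite !mxE.
rewrite (reindex f); last exact: onW_bij.
by apply: eq_bigr => k _; rewrite !mxE.
Qed.

(* Jacobi's complementary minor identity, for principal minors. *)
Lemma det_principal_complement (F : comUnitRingType) n (S : 'M[F]_n)
    (A : {set 'I_n}) :
  S \in unitmx ->
  \det (mxsub (@enum_val _ (mem A)) (@enum_val _ (mem A)) S) =
  \det S * \det (mxsub (@enum_val _ (mem (~: A))) (@enum_val _ (mem (~: A)))
                       (invmx S)).
Proof.
move=> S_unit; set g := @enum_val _ _; set h := @enum_val _ _.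
(* The bijection [f] lists the vertices of [A] first, which exhibits the two minors as diagonal
   blocks. *)
pose f (k : 'I_(#|A| + #|~: A|)) :=
  match split k with inl i => g i | inr j => h j end.
have fl i : f (lshift _ i) = g i by rewrite /f (unsplitK (inl i)).
have fr j : f (rshift _ j) = h j by rewrite /f (unsplitK (inr j)).
have bij_f : bijective f.
  apply: inj_card_bij; last by rewrite !card_ord cardsC card_ord.
  have gh i j : g i != h j.
    apply: contraTneq (enum_valP i) => /= gh.
    by have := enum_valP j; rewrite -/(h j) -gh inE.
  move=> x y; case: (split_ordP x) => i ->; case: (split_ordP y) => j ->;
    rewrite ?fl ?fr => E.
  - by rewrite (enum_val_inj E).
  - by case/eqP: (gh i j).
  - by case/eqP: (gh j i).
  - by rewrite (enum_val_inj E).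
have mxsubE (M : 'M[F]_n) :
  mxsub f f M =
    block_mx (mxsub g g M) (mxsub g h M) (mxsub h g M) (mxsub h h M).
  rewrite -[LHS]submxK; congr block_mx;
    by apply/matrixP=> i j; rewrite !mxE ?fl ?fr.
have := mulmx_mxsub_bij S (invmx S) bij_f; rewrite mulmxV // !mxsubE.
rewrite mulmx_block => /eq_block_mx[_ eq_ur _ eq_dr].
have h1 : mxsub h h 1%:M = 1%:M :> 'M[F]_#|~: A|.
  by apply/matrixP=> i j; rewrite !mxE (inj_eq enum_val_inj).
have gh0 : mxsub g h 1%:M = 0 :> 'M[F]_(#|A|, #|~: A|).
  apply/matrixP=> i j; rewrite !mxE -fl -fr (bij_eq bij_f).
  by rewrite eq_lrshift.
rewrite -(det_mxsub_bij S bij_f) mxsubE.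
(* The left block column of the inverse is replaced by that of the identity. The product is then
   lower triangular with diagonal blocks the minor of [S] on [A] and the identity. *)
transitivity (\det (mxsub f f S *m
    block_mx 1%:M (mxsub g h (invmx S)) 0 (mxsub h h (invmx S)))).
  rewrite mxsubE mulmx_block !mulmx1 !mulmx0 !addr0 eq_ur eq_dr gh0 h1.
  by rewrite det_lblock det1 mulr1.
by rewrite det_mulmx det_ublock det1 mul1r mxsubE.
Qed.

Lemma det_mx2_skew (R : comPzRingType) (M : 'M[R]_2) :
  M 0 0 = 0 -> M 1 1 = 0 -> M 1 0 = - M 0 1 -> \det M = M 0 1 ^+ 2.
Proof.
rewrite (expand_det_row _ 0) !big_ord_recl big_ord0 /= => M00 M11 M10.
rewrite M00 mul0r add0r addr0 /cofactor det_mx11 !mxE.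
have -> : lift ord0 ord0 = 1 :> 'I_2 by apply/val_inj.
have -> : lift 1 0 = 0 :> 'I_2 by apply/val_inj.
by rewrite M10 add0n expr1 mulN1r opprK expr2.
Qed.

(** * Coefficients of characteristic polynomials *)

(* Since t I - A = - (t A) (t^-1 I - A^-1), both sides are the coefficients of
   polynomials that agree at every nonzero t. *)
Lemma char_poly_inv_coef (F : numFieldType) n (A : 'M[F]_n) i :
  A \in unitmx -> (i <= n)%N ->
  (char_poly A)`_i = (-1) ^+ n * \det A * (char_poly (invmx A))`_(n - i).
Proof.
move=> A_unit le_in; set B := invmx A; set c := _ * \det A.
have horner_char (M : 'M[F]_n) t : (char_poly M).[t] = \det (t%:M - M).
  rewrite -[LHS]/(horner_eval t _) /char_poly -det_map_mx; congr (\det _).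
  apply/matrixP=> k l; rewrite !mxE /horner_eval.
  by rewrite /= /horner_eval !hornerE hornerMn hornerX.
pose q := \poly_(j < n.+1) (c * (char_poly B)`_(n - j)).
have eq_on_nz t : t != 0 -> (char_poly A).[t] = q.[t].
  move=> t0; rewrite horner_char.
  have -> : t%:M - A = - (t *: A) *m (t^-1%:M - B).
    rewrite mulNmx -mulmxN opprB mulmxBr -scalemxAl mulmxV // scalemx1.
    by rewrite mul_mx_scalar scalerA mulVf // scale1r.
  rewrite det_mulmx -scaleN1r scalerA detZ mulN1r exprNn -horner_char.
  rewrite (horner_coef_wide _ (n := n.+1)) ?size_char_poly // horner_poly.
  rewrite (reindex_inj rev_ord_inj) mulr_sumr; apply: eq_bigr => j _ /=.
  have le_jn : (j <= n)%N by rewrite -ltnS.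
  have -> : t ^+ n = t ^+ (n - j) * t ^+ j by rewrite -exprD subnK.
  rewrite subSS /c exprVn.
  have : t ^+ (n - j) != 0 by rewrite expf_neq0.
  set u := t ^+ (n - j) => u0; field; exact: u0.
suff -> : char_poly A = q by rewrite coef_poly ltnS le_in.
apply/eqP; rewrite -subr_eq0; apply: contraT => nz_d.
(* The points 1, ..., n+1 are more roots than a nonzero polynomial of degree at most n can have. *)
pose rs := [seq k.+1%:R : F | k <- iota 0 n.+1].
have all_rs : all (root (char_poly A - q)) rs.
  apply/allP=> _ /mapP[k _ ->]; rewrite rootE hornerD hornerN subr_eq0.
  by rewrite eq_on_nz // pnatr_eq0.
have uniq_rs : uniq rs.
  rewrite map_inj_uniq ?iota_uniq // => k l /eqP.
  by rewrite eqr_nat eqSS => /eqP.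
have := max_poly_roots nz_d all_rs uniq_rs.
rewrite size_map size_iota ltnNge => /negP[].
rewrite (leq_trans (size_polyD _ _)) // size_polyN geq_max size_char_poly leqnn.
exact: size_poly.
Qed.

(** Transposition turns [x I - S] into [x I + S] without changing the determinant, and the product
    of the two is [x^2 I - S^2]. *)
Lemma char_poly_sqr (F : comNzRingType) n (S : 'M[F]_n) :
  S^T = - S -> char_poly S ^+ 2 = char_poly (S *m S) \Po 'X^2.
Proof.
move=> skewS.
have char_tr : char_poly S = \det ('X%:M + map_mx polyC S).
  rewrite /char_poly -det_tr; congr (\det _); apply/matrixP=> i j.
  have /matrixP/(_ i j) := skewS; rewrite !mxE eq_sym => ->.
  by rewrite polyCN opprK.
rewrite expr2 {2}char_tr -det_mulmx -[RHS]/((comp_poly 'X^2) _) -det_map_mx.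
congr (\det _).
rewrite mulmxDr !mulmxBl -!map_mxM addrA.
rewrite (scalar_mxC 'X (map_mx polyC S)) addrNK -scalar_mxM -expr2.
apply/matrixP=> i j; rewrite !mxE /=.
by rewrite comp_polyB comp_polyC; case: (i == j);
  rewrite ?comp_polyX ?mulr0n ?comp_poly0.
Qed.

(** Reversal of coefficients sends index 1 to index n-1, where the trace of the inverse sits. For n
    = 0 both sides vanish. *)
Lemma char_poly_coef1 (F : numFieldType) n (A : 'M[F]_n) :
  A \in unitmx ->
  (char_poly A)`_1 = (-1) ^+ n.+1 * \det A * \tr (invmx A).
Proof.
case: n A => [|n] A A_unit.
  by rewrite /mxtrace big_ord0 mulr0 nth_default // size_char_poly.
rewrite char_poly_inv_coef // subn1 char_poly_trace // mulrN [in RHS]exprS.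
by rewrite mulN1r !mulNr.
Qed.

(** * Skew-symmetric matrices *)

Lemma even_det_skew (F : numFieldType) n (S : 'M[F]_n) :
  S^T = - S -> \det S != 0 -> ~~ odd n.
Proof.
move=> skewS; apply: contra => odd_n.
have : \det S = - \det S.
  by rewrite -{1}det_tr skewS -scaleN1r detZ -signr_odd odd_n mulN1r.
by move/eqP; rewrite -addr_eq0 -mulr2n mulrn_eq0.
Qed.

Lemma skew_mxE (R : pzRingType) n (S : 'M[R]_n) i j :
  S^T = - S -> S i j = - S j i.
Proof. by move=> /matrixP/(_ j i); rewrite !mxE. Qed.

Lemma skew_mx_diag (F : numDomainType) n (S : 'M[F]_n) i :
  S^T = - S -> S i i = 0.
Proof.
move=> /(skew_mxE i i)/eqP.
by rewrite -addr_eq0 -mulr2n mulrn_eq0 => /eqP.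
Qed.

Lemma skew_invmx (F : comUnitRingType) n (S : 'M[F]_n) :
  S^T = - S -> S \in unitmx -> (invmx S)^T = - invmx S.
Proof.
move=> skewS unitS; apply: (can_inj (mulKmx unitS)); rewrite trmx_inv skewS.
have unitNS : - S \in unitmx by rewrite -skewS unitmx_tr.
by rewrite mulmxN mulmxV // -{1}[S]opprK mulNmx mulmxV.
Qed.

(** Compare the coefficients of x^2 in [char_poly_sqr]. On the left, with c_0 = 1 and c_1 = 0 (the
    inverse has trace 0), 2 c_0 c_2 + c_1^2 is 2 c_2; on the right stands the linear coefficient for
    [S *m S]. *)
Lemma skew_char_poly_coef2 (F : numFieldType) n (S : 'M[F]_n) :
  S^T = - S -> \det S = 1 ->
  (char_poly S)`_2 *+ 2 = - \tr (invmx S *m invmx S).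
Proof.
move=> skewS det1S; have unitS : S \in unitmx by rewrite unitmxE det1S unitr1.
have even_n : ~~ odd n by apply: even_det_skew skewS _; rewrite det1S oner_eq0.
have detSS : \det (S *m S) = 1 by rewrite det_mulmx det1S mulr1.
have unitSS : S *m S \in unitmx by rewrite unitmxE detSS unitr1.
have invSS : invmx (S *m S) = invmx S *m invmx S.
  apply: (can_inj (mulKmx unitSS)); rewrite mulmxV // mulmxA mulmxK //.
  by rewrite mulmxV.
have tr_inv0 : \tr (invmx S) = 0.
  by apply: big1 => i _; apply: skew_mx_diag; apply: skew_invmx.
have := congr1 (fun p : {poly F} => p`_2) (char_poly_sqr skewS).
rewrite coef_comp_poly_Xn //= (_ : 2 %/ 2 = 1)%N // char_poly_coef1 // invSS.
rewrite expr2 coefM !big_ord_recl big_ord0 /= /bump /= !addn0.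
rewrite !char_poly_coef1 // tr_inv0 char_poly_det det1S detSS.
have sgn_n : (-1) ^+ n = 1 :> F by rewrite -signr_odd (negbTE even_n).
rewrite exprS sgn_n !mulr1 !mulr0 !mul1r add0r mulN1r mulr2n => <-.
by rewrite addr0.
Qed.

(** * Tournament matrices and their inverses *)

Lemma skew_adjacency_skew n (T : tournament n) :
  (skew_adjacency T)^T = - skew_adjacency T.
Proof.
apply/matrixP=> i j; rewrite !mxE; have [->|/(dominates_total T)] := eqVneq i j.
  by rewrite dominates_irr oppr0.
by case: (dominates T i j); case: (dominates T j i); rewrite ?opprK.
Qed.

Lemma invmx_skew_adjacency_odd n (T : tournament n) (i j : 'I_n) :
  unimodular T -> i != j ->
  exists k : int, invmx (skew_adjacency T) i j = (2 * k + 1)%:~R.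
Proof.
rewrite /unimodular; set S := skew_adjacency T => detS neq_ij.
have even_n : ~~ odd n.
  by apply: even_det_skew (skew_adjacency_skew T) _; rewrite detS oner_eq0.
(* An integral copy of [S]: its determinant is 1, so its adjugate is an integral inverse, which can
   be reduced modulo 2. *)
pose Z : 'M[int]_n := \matrix_(i, j)
  (if dominates T i j then 1 else if dominates T j i then -1 else 0).
have defS : S = map_mx intr Z.
  by apply/matrixP=> k l; rewrite !mxE; do 2!case: ifP => // _.
have detZ : \det Z = 1.
  by apply: (@intr_inj rat); rewrite -det_map_mx -defS detS.
have ZY : Z *m \adj Z = 1%:M by rewrite mul_mx_adj detZ.
have -> : invmx S = map_mx intr (\adj Z).
  have unitS : S \in unitmx by rewrite unitmxE detS unitr1.
  apply: (can_inj (mulKmx unitS)); rewrite mulmxV //.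
  by rewrite defS -map_mxM ZY map_mx1.
have char2 : 2 \in [pchar 'F_2] by apply: pchar_Fp.
pose J : 'M['F_2]_n := const_mx 1; pose Z2 := J - 1%:M.
have Z2E : map_mx intr Z = Z2.
  apply/matrixP=> k l; rewrite !mxE.
  have [->|neq_kl] := eqVneq k l; first by rewrite dominates_irr subrr.
  have := dominates_total T neq_kl; rewrite subr0.
  case: (dominates T k l) => //=; case: (dominates T l k) => //= _.
  by rewrite rmorphN1 (oppr_pchar2 char2).
have JJ : J *m J = 0.
  apply/matrixP=> k l; rewrite !mxE (eq_bigr (fun=> 1)); last first.
    by move=> m _; rewrite !mxE mulr1.
  rewrite sumr_const card_ord; apply/eqP.
  by rewrite -(dvdn_pcharf char2) dvdn2 even_n.
have Z2Z2 : Z2 *m Z2 = 1%:M.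
  rewrite mulmxBr !mulmxBl JJ !mulmx1 mul1mx sub0r.
  rewrite opprB addrCA -opprD (_ : J + J = 0) ?subr0 //.
  by apply/matrixP=> k l; rewrite !mxE (addrr_pchar2 char2).
have Y2E : map_mx intr (\adj Z) = Z2.
  by rewrite -[LHS]mul1mx -Z2Z2 -mulmxA -Z2E -map_mxM ZY map_mx1 mulmx1.
have : (\adj Z i j)%:~R == 1 :> 'F_2.
  have /matrixP/(_ i j) := Y2E; rewrite [LHS]mxE => ->.
  by rewrite !mxE (negbTE neq_ij) subr0.
rewrite -subr_eq0 -(rmorph1 intr) -rmorphB -(dvdz_pcharf char2).
case/dvdzP=> k Yk; exists k; rewrite mxE; congr (_%:~R).
by rewrite mulrC -Yk subrK.
Qed.

Lemma unimodular_subtournament n (T : tournament n) (A : {set 'I_n}) i j :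
  unimodular T -> i != j -> ~: A = [set i; j] ->
  (unimodular (subtournament T A) <-> invmx (skew_adjacency T) i j ^+ 2 = 1).
Proof.
rewrite /unimodular => detS neq_ij defA; set S := skew_adjacency T in detS *.
have skewS : S^T = - S := skew_adjacency_skew T.
have unitS : S \in unitmx by rewrite unitmxE detS unitr1.
have skewB k l := skew_mxE k l (skew_invmx skewS unitS).
have diagB k := skew_mx_diag k (skew_invmx skewS unitS).
have -> : skew_adjacency (subtournament T A) =
          mxsub (@enum_val _ (mem A)) (@enum_val _ (mem A)) S.
  by apply/matrixP=> k l; rewrite !mxE.
rewrite det_principal_complement // detS mul1r.
have card2 : #|~: A| = 2 by rewrite defA cards2 neq_ij.
have injh := @enum_val_inj _ (mem (~: A)).
have hE k : @enum_val _ (mem (~: A)) k \in [set i; j].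
  by rewrite -defA; apply: enum_valP.
(* Only the injectivity of the enumeration and its range are kept, so that the size of the minor can
   be rewritten to 2. *)
move: (@enum_val _ (mem (~: A))) injh hE; rewrite card2 => h injh hE.
rewrite det_mx2_skew ?mxE ?diagB //.
(* The enumeration may list [i] and [j] in either order; the square absorbs the sign. *)
have : h 0 != h 1 by rewrite (inj_eq injh).
have /set2P[] := hE 0; have /set2P[] := hE 1; move=> -> -> //; rewrite ?eqxx //.
by rewrite skewB sqrrN.
Qed.

Theorem proposition4p1 (n : nat) (T : tournament n) (hT : unimodular T) :
  (forall i j : 'I_n, i != j ->
     exists k : int, invmx (skew_adjacency T) i j = (2 * k + 1)%:~R) /\
  (invertible T <->
     (forall A : {set 'I_n}, (#|A| + 2 = n)%N ->
        unimodular (subtournament T A))) /\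
  ((forall A : {set 'I_n}, (#|A| + 2 = n)%N ->
      unimodular (subtournament T A)) <->
     (char_poly (skew_adjacency T))`_2 = 'C(n, 2)%:R).
Proof.
have oddB i j := @invmx_skew_adjacency_odd n T i j hT.
split=> //; set S := skew_adjacency T in oddB *.
have detS : \det S = 1 := hT.
have skewS : S^T = - S := skew_adjacency_skew T.
have unitS : S \in unitmx by rewrite unitmxE detS unitr1.
set B := invmx S in oddB *.
have skewB i j : B i j = - B j i := skew_mxE i j (skew_invmx skewS unitS).
have diagB i : B i i = 0 := skew_mx_diag i (skew_invmx skewS unitS).
pose unitB := forall i j : 'I_n, i != j -> B i j ^+ 2 = 1.
have inv_unitB : invertible T <-> unitB.
  split=> [[_ [T' defB]] i j neq_ij | sqrB].
    rewrite -/S -/B in defB; rewrite defB mxE.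
    have := dominates_total T' neq_ij.
    by do 2!case: (dominates T' _ _); rewrite //= ?sqrrN expr1n.
  have B_pm1 i j : i != j -> (B i j == 1) || (B i j == -1).
    by move=> neq_ij; rewrite -sqrf_eq1 sqrB.
  split=> //; have irr : irreflexive (fun i j => B i j == 1).
    by move=> i; rewrite diagB eq_sym oner_eq0.
  have tot i j : i != j -> (B i j == 1) (+) (B j i == 1).
    move=> neq_ij; rewrite (skewB j i).
    by case/orP: (B_pm1 i j neq_ij) => /eqP->.
  exists (Tournament irr tot); apply/matrixP=> i j; rewrite mxE /= -/S -/B.
  have [->|neq_ij] := eqVneq i j; first by rewrite diagB.
  by rewrite (skewB j i); case/orP: (B_pm1 i j neq_ij) => /eqP->.
have sub_unitB : (forall A : {set 'I_n}, (#|A| + 2 = n)%N ->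
    unimodular (subtournament T A)) <-> unitB.
  split=> [uniA i j neq_ij | sqrB A cardA].
    have defA : ~: ~: [set i; j] = [set i; j] by rewrite setCK.
    apply/(unimodular_subtournament hT neq_ij defA)/uniA.
    by rewrite addnC -[RHS](card_ord n) -(cardsC [set i; j]) cards2 neq_ij.
  have /eqP/cards2P[i [j [neq_ij defA]]] : #|~: A| = 2.
    by apply: (@addnI #|A|); rewrite cardsC card_ord.
  exact/(unimodular_subtournament hT neq_ij defA)/sqrB.
have coef_unitB : (char_poly S)`_2 = 'C(n, 2)%:R <-> unitB.
  (* An odd integer is nonzero, so its square is at least 1. *)
  have sqr_ge1 i j : i != j -> 1 <= B i j ^+ 2.
    move=> neq_ij; have [k Bk] := oddB i j neq_ij.
    apply: sqr_intr_ge1; first by rewrite Bk intr_int.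
    rewrite Bk intr_eq0; apply/eqP=> k0.
    by have := congr1 (fun z => z %% 2)%Z k0; rewrite mulrC modzMDl.
  (* Doubling turns sums over unordered pairs into sums over ordered pairs. *)
  have coefE : (char_poly S)`_2 *+ 2 = \sum_i \sum_(j | j != i) B i j ^+ 2.
    rewrite skew_char_poly_coef2 // -/B /mxtrace -sumrN.
    apply: eq_bigr => i _; rewrite mxE -sumrN (bigD1 i) //=.
    rewrite diagB mul0r oppr0 add0r.
    by apply: eq_bigr => j _; rewrite (skewB j i) mulrN opprK expr2.
  have binE : 'C(n, 2)%:R *+ 2 = \sum_(i < n) \sum_(j < n | j != i) 1 :> rat.
    rewrite (eq_bigr (fun=> n.-1%:R)); last first.
      by move=> i _; rewrite sumr_const cardC1 card_ord.
    rewrite sumr_const card_ord -!mulrnA (bin_ffact n 2).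
    by rewrite ffactnS ffactn1 mulnC.
  (* The inequality holds term by term, so the two sums agree only if every term does. *)
  have leif_coef : 'C(n, 2)%:R *+ 2 <= (char_poly S)`_2 *+ 2
      ?= iff [forall i, forall (j | j != i), 1 == B i j ^+ 2].
    rewrite binE coefE; apply: leif_sum => i _; apply: leif_sum => j neq_ji.
    apply/leifP; case: eqVneq => // neq1.
    by rewrite lt_neqAle neq1 sqr_ge1 // eq_sym.
  case: leif_coef => _; rewrite eqrMn2r /= (eq_sym 'C(n, 2)%:R) => coef_eq.
  split=> [/eqP | sqrB].
    rewrite coef_eq => /forallP sqrB i j neq_ij.
    by have /forall_inP/(_ j) := sqrB i; rewrite eq_sym => /(_ neq_ij)/eqP <-.
  apply/eqP; rewrite coef_eq.
  by apply/forallP=> i; apply/forall_inP=> j neq_ji; rewrite sqrB // eq_sym.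
by split; [rewrite inv_unitB sub_unitB | rewrite sub_unitB coef_unitB].
Qed.
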